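(* There is an absolute constant $c>0$ such that for every positive integer $w$ and every integer $t\ge \operatorname{tow}(\lceil c w\rceil)$, every worker-task assignment function for $w$ workers and $t$ tasks has switching cost exactly $w$ (i.e. there exist two adjacent task multisets on which all $w$ workers change their assigned task).
   Context: $\operatorname{tow}(n)$ denotes a tower of twos of height $n$ ($\operatorname{tow}(1)=2$, $\operatorname{tow}(n+1)=2^{\operatorname{tow}(n)}$). A task multiset is a multiset $T$ of size $w$ with elements in $[t]$; $m_T(j)$ is the multiplicity of $j$. A worker-task assignment function $\phi$ assigns to every task multiset $T$ a map $\phi(T):[w]\to[t]$ with exactly $m_T(j)$ workers mapped to each $j$. Task multisets $T_1,T_2$ of size $w$ are adjacent if $|T_1\setminus T_2|=|T_2\setminus T_1|=1$ (multiset difference). The switching cost of $\phi$ is the maximum, over adjacent $T_1,T_2$, of the number of workers $i$ with $\phi(T_1)(i)\ne\phi(T_2)(i)$. *)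

(* Defs.v *)
From HB Require Import structures.
From mathcomp Require Import all_boot all_order all_algebra.
From mathcomp Require Import finmap multiset.
From mathcomp Require Import reals.

Set Implicit Arguments.
Unset Strict Implicit.
Unset Printing Implicit Defensive.

Local Open Scope nat_scope.

(* The value 1 at height 0 is the one compatible with tow 1 = 2. *)
Fixpoint tow (n : nat) : nat := if n is m.+1 then 2 ^ tow m else 1.

(* [size] counts the elements of a multiset with multiplicity. The task set
   [t] = {1, ..., t} is represented by 'I_t = {0, ..., t - 1}, and likewise
   the set [w] of workers by 'I_w. *)
Record task_multiset (w t : nat) := TaskMultiset {
  task_mset :> {mset 'I_t}%mset;
  _ : size task_mset == w
}.

HB.instance Definition _ w t := [isSub for @task_mset w t].
HB.instance Definition _ w t := [Choice of task_multiset w t by <:].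

Definition mult (w t : nat) (T : task_multiset w t) (j : 'I_t) : nat :=
  task_mset T j.

(* Multiplicities are at most w, so there are finitely many task multisets;
   this makes the maximum in [switching_cost] a finite one. *)
Section TaskMultisetFinite.
Variables w t : nat.

Definition task_mult (T : task_multiset w t) : {ffun 'I_t -> 'I_w.+1} :=
  [ffun j => inord (mult T j)].

Definition task_of_mult (f : {ffun 'I_t -> 'I_w.+1}) :
    option (task_multiset w t) :=
  insub (seq_mset (flatten [seq nseq (f j) j | j <- enum 'I_t])).

Lemma task_mult_leq (T : task_multiset w t) j : mult T j <= w.
Proof.
by rewrite /mult; case: T => T /= /eqP <-; rewrite -count_mem_mset count_size.
Qed.

Lemma task_multK : pcancel task_mult task_of_mult.
Proof.
move=> T; rewrite /task_of_mult; set S := seq_mset _.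
suff -> : S = val T by rewrite valK.
apply/msetP => j; rewrite mset_seqE count_flatten sumn_map big_map /=.
rewrite big_enum /= (bigD1 j) //= count_nseq /= eqxx mul1n.
rewrite ffunE inordK ?ltnS ?task_mult_leq // big1 ?addn0 // => i /negbTE nij.
by rewrite count_nseq /= nij.
Qed.

End TaskMultisetFinite.

HB.instance Definition _ w t : isCountable (task_multiset w t) :=
  PCanIsCountable (@task_multK w t).
HB.instance Definition _ w t : isFinite (task_multiset w t) :=
  PCanIsFinite (@task_multK w t).

Definition adjacent (w t : nat) (T1 T2 : task_multiset w t) : bool :=
  (size (T1 `\` T2)%mset == 1) && (size (T2 `\` T1)%mset == 1).

Record assignment (w t : nat) := Assignment {
  assign :> task_multiset w t -> 'I_w -> 'I_t;
  assignP : forall (T : task_multiset w t) (j : 'I_t),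
    #|[set i | assign T i == j]| = mult T j
}.

Definition switches (w t : nat) (phi : assignment w t)
    (T1 T2 : task_multiset w t) : nat :=
  #|[set i | phi T1 i != phi T2 i]|.

(* The maximum over the empty set of pairs is 0; this concerns only
   w = 0 or t <= 1, where no two task multisets are adjacent. *)
Definition switching_cost (w t : nat) (phi : assignment w t) : nat :=
  \max_(T : task_multiset w t * task_multiset w t | adjacent T.1 T.2)
    switches phi T.1 T.2.

(* Main.v *)
(* Restrict [phi] to increasing tuples x_1 < ... < x_w of tasks and colour each
   tuple by the map sending a worker to the position of its task in the tuple.
   If the shifted tuples (x_1, ..., x_w) and (x_2, ..., x_{w+1}) get the same
   colour, then every worker changes task between them. Such a pair exists
   because the shift graph on w-tuples from [t] has large chromatic number: a
   proper colouring of k-tuples by C induces a proper colouring of (k-1)-tuples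
   by subsets of C (the colours of the one-point extensions), so a proper
   colouring of w-tuples forces t to be at most a tower of height O(w). *)
Require Import Defs.
From mathcomp Require Import all_boot all_order all_algebra.
From mathcomp Require Import finmap multiset.
From mathcomp Require Import reals zify.
Import Order.TTheory GRing.Theory Num.Theory.
Local Open Scope ring_scope.

Lemma exists_shift_monochromatic (T C : finType) (e : rel T) (k : nat)
    (f : seq T -> C) :
  (forall x y, x != y -> e x y || e y x) ->
  (iter k (expn 2) #|C| < #|T|)%N ->
  exists x s y, [/\ path e x (rcons s y), size s = k &
                    f (x :: s) = f (rcons s y)].
Proof.
move=> e_total; elim: k C f => [|k IHk] C f ltCT.
  have /injectivePn[x [y neq_xy eq_f]] :
      ~~ injectiveb (fun x : T => f [:: x]).
    apply/negP => /injectiveP inj_f.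
    by move: ltCT; rewrite /= ltnNge (leq_card _ inj_f).
  case/orP: (e_total _ _ neq_xy) => e_xy.
    by exists x, [::], y; split; rewrite //= e_xy.
  by exists y, [::], x; split; rewrite //= e_xy.
(* Only extensions that keep the sequence sorted are collected, so that a colour found in [g] comes
   with an increasing tuple. *)
pose g s := [set f (rcons s z) | z : T & sorted e (rcons s z)].
have [|x [s [y [e_xsy size_s eq_g]]]] := IHk {set C} g.
  by rewrite -cardsT -powersetT card_powerset cardsT -iterSr.
(* This colour also lies in [g (rcons s y)], so some extension of [rcons s y] by a point [z]
   realises it. *)
have : f (x :: rcons s y) \in g (x :: s).
  by apply/imsetP; exists y; rewrite ?inE.
rewrite eq_g => /imsetP[z]; rewrite inE => e_syz eq_f.
exists x, (rcons s y), z; split; rewrite ?size_rcons ?size_s //.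
rewrite rcons_path e_xsy last_rcons.
case: s e_syz {e_xsy size_s eq_g eq_f} => [/andP[]//|a s].
by rewrite /= rcons_path last_rcons => /andP[].
Qed.

Lemma ltn_tow_S n : (tow n < tow n.+1)%N.
Proof. exact: ltn_expl. Qed.

Lemma tow_homo_ltn : {homo tow : m n / (m < n)%N}.
Proof. by apply: homo_ltn => [? ? ?|]; [exact: ltn_trans | exact: ltn_tow_S]. Qed.

Lemma leq_tow n : (n <= tow n)%N.
Proof. by elim: n => // n IHn; apply: leq_ltn_trans IHn (ltn_tow_S n). Qed.

Lemma iter_exp2_tow k m : iter k (expn 2) (tow m) = tow (k + m).
Proof. by elim: k => //= k ->. Qed.

Lemma leq_iter_exp2 k m n :
  (m <= n)%N -> (iter k (expn 2) m <= iter k (expn 2) n)%N.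
Proof. by move=> le_mn; elim: k => //= k; rewrite leq_exp2l. Qed.

Lemma leq_expnn_tow n : (n ^ n <= tow (n + n).+2)%N.
Proof.
apply: (@leq_trans (2 ^ (n * n))).
  by rewrite expnM; case: n => // n; rewrite leq_exp2r // ltnW // ltn_expl.
rewrite /= leq_exp2l //; apply: (@leq_trans (2 ^ (n + n))).
  by rewrite expnD leq_mul // ltnW // ltn_expl.
by rewrite leq_exp2l // leq_tow.
Qed.

(** The bound on the number of colours gives height [n + 2(n + 1) + 2 = 3n + 4]; 5 is the least
    integer [c] with [3n + 4 < c(n + 1)] for all [n], the case [n = 0] being the tight one. *)
Lemma iter_exp2_expnn_tow n :
  (iter n (expn 2) (n.+1 ^ n.+1) < tow (5 * n.+1))%N.
Proof.
apply: leq_ltn_trans (leq_iter_exp2 n _ _ (leq_expnn_tow n.+1)) _.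
by rewrite iter_exp2_tow; apply: tow_homo_ltn; lia.
Qed.

Lemma assign_mem (w t : nat) (phi : assignment w t) (T : task_multiset w t)
    (s : seq 'I_t) (i : 'I_w) : task_mset T = seq_mset s -> phi T i \in s.
Proof.
move=> eqT; rewrite -has_pred1 has_count -mset_seqE -eqT -/(mult T _).
by rewrite -(assignP phi) card_gt0; apply/set0Pn; exists i; rewrite inE.
Qed.

Lemma size_seq_mset (K : choiceType) (s : seq K) : size (seq_mset s) = size s.
Proof. exact/perm_size/perm_eq_seq_mset. Qed.

Lemma size_msetB_cons (K : choiceType) (x y : K) (s : seq K) :
  x != y -> size (seq_mset (x :: s) `\` seq_mset (y :: s))%mset = 1%N.
Proof.
move=> neq_xy; rewrite (_ : (_ `\` _)%mset = seq_mset [:: x]) ?size_seq_mset //.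
apply/msetP => j; rewrite msetE2 !mset_seqE /= subnDr addn0.
by case: (eqVneq x j) neq_xy => [-> | _]; rewrite ?sub0n // eq_sym => /negbTE->.
Qed.

Lemma switching_cost_leq (w t : nat) (phi : assignment w t) :
  (switching_cost phi <= w)%N.
Proof.
by apply/bigmax_leqP => T _; rewrite -[leqRHS]card_ord max_card.
Qed.

(** Both indices can be compared inside [x :: rcons s y]: appending [y] keeps the index of [a],
    while prepending [x], which differs from [a], raises it by one. *)
Lemma index_shift_neq (K : eqType) (x y a : K) (s : seq K) :
  uniq (x :: rcons s y) -> a \in x :: s -> a \in rcons s y ->
  index a (x :: s) != index a (rcons s y).
Proof.
move=> uniq_xsy a_xs a_sy; apply: contraTneq a_xs => eq_a.
have: index a (rcons (x :: s) y) = (index a (rcons s y)).+1.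
  rewrite rcons_cons /= ifN //; apply: contraTneq a_sy => <-.
  by case/andP: uniq_xsy.
rewrite -cats1 index_cat; case: ifP => // _ eq_S.
by rewrite eq_S in eq_a; lia.
Qed.

Lemma exists_adjacent_switches (n t : nat) (phi : assignment n.+1 t) :
  (iter n (expn 2) (n.+1 ^ n.+1) < t)%N ->
  exists2 T, adjacent T.1 T.2 & switches phi T.1 T.2 = n.+1.
Proof.
move=> lt_t; pose D := {ffun 'I_n.+1 -> 'I_n.+1}.
(* The default colour is only for sequences of length other than [n.+1]. *)
pose f (s : seq 'I_t) : D :=
  if insub (seq_mset s) is Some T
  then [ffun i => inord (index (phi T i) s)] else [ffun=> ord0].
have [||x [s [y [lt_xsy size_s eq_f]]]] :=
    @exists_shift_monochromatic 'I_t D (fun i j => (i < j)%N) n f.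
- by move=> i j; rewrite neq_ltn.
- by rewrite card_ffun !card_ord.
have uniq_xsy : uniq (x :: rcons s y).
  apply: (@sorted_uniq _ (fun i j : 'I_t => (i < j)%N)) => //.
    by move=> ? ? ?; apply: ltn_trans.
  by move=> ?; rewrite ltnn.
have neq_xy : x != y.
  by apply: contraTneq uniq_xsy => ->; rewrite /= mem_rcons mem_head.
have szP (r : seq 'I_t) : size r = n.+1 -> size (seq_mset r) == n.+1.
  by move=> <-; rewrite size_seq_mset.
have size1 : size (x :: s) = n.+1 by rewrite /= size_s.
have size2 : size (rcons s y) = n.+1 by rewrite size_rcons size_s.
pose T1 := TaskMultiset (szP _ size1); pose T2 := TaskMultiset (szP _ size2).
exists (T1, T2).
  have /eq_seq_msetP eq_sy : perm_eq (rcons s y) (y :: s) by rewrite perm_rcons.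
  by rewrite /adjacent /= eq_sy !size_msetB_cons // eq_sym.
rewrite -[RHS]card_ord -cardsT; congr #|pred_of_set _|.
(* A worker keeping its task would, by equality of colours, see that task at the same position in
   both tuples. *)
apply/setP => i; rewrite !inE; apply/negP => /eqP eq_phi.
have mem1 : phi T1 i \in x :: s by exact: assign_mem.
have mem2 : phi T1 i \in rcons s y by rewrite eq_phi; exact: assign_mem.
have fE r (sz : size (seq_mset r) == n.+1) :
    f r = [ffun j => inord (index (phi (TaskMultiset sz) j) r)].
  by rewrite /f insubT.
move: eq_f; rewrite (fE _ (szP _ size1)) (fE _ (szP _ size2)) -/T1 -/T2.
have lt1 : (index (phi T1 i) (x :: s) < n.+1)%N.
  by rewrite -[X in (_ < X)%N]size1 index_mem.
have lt2 : (index (phi T1 i) (rcons s y) < n.+1)%N.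
  by rewrite -[X in (_ < X)%N]size2 index_mem.
move=> /ffunP/(_ i); rewrite !ffunE -eq_phi => /(congr1 (@nat_of_ord _)).
by rewrite (inordK lt1) (inordK lt2); apply/eqP; apply: index_shift_neq.
Qed.

(* For c > 0 the integer Num.ceil (c * w%:R) is positive, so its absolute
   value `|_|%N is just its natural-number value. *)
Theorem theorem3 (R : realType) :
  exists c : R, 0 < c /\
    forall w t : nat, (0 < w)%N ->
      (tow `|Num.ceil (c * w%:R)|%N <= t)%N ->
      forall phi : assignment w t, switching_cost phi = w.
Proof.
exists 5%:R; split; first by rewrite ltr0n.
case=> // n t _; rewrite -natrM pmulrn intrKceil absz_nat => le_t phi.
have [|T adjT switchT] := exists_adjacent_switches n t phi.
  exact: leq_trans (iter_exp2_expnn_tow n) le_t.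
apply/eqP; rewrite eqn_leq switching_cost_leq -[X in (X <= _)%N]switchT.
exact: (bigop.bigmax_sup T).
Qed.
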